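(* Let $M$ be a $(2n+1)$-dimensional $N(\kappa)$-contact metric manifold. For each of the special curvature tensors $\mathcal{K}$ listed below, if $M$ is $\mathcal{K}$-flat, i.e. $g(\mathcal{K}(X_1,X_2)X_3,X_4)=0$ for all vector fields $X_1,\dots,X_4$ on $M$, then $\kappa$ is as follows: - $\mathcal{C}_\star,\ \mathcal{V},\ \mathcal{P}_\star,\ \mathcal{P},\ \mathcal{M},\ \mathcal{W}_0,\ \mathcal{W}_1^\star,\ \mathcal{W}_6,\ \mathcal{W}_8$: $\kappa=\frac{n-1}{n}$; - $\mathcal{W}_0^\star,\ \mathcal{W}_1$: $\kappa=\frac{1-n}{n}$; - $\mathcal{L}$: $\kappa=2-2n$; - $\mathcal{W}_3,\ \mathcal{W}_4,\ \mathcal{W}_5$: $\kappa=0$; - $\mathcal{W}_7$: $\kappa=\frac{n-1}{2n}$; - $\mathcal{C},\ \mathcal{W}_2,\ \mathcal{W}_9$: $\kappa$ is a real number (no specific value is determined).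
   Context: A contact metric manifold $(M^{2n+1},\varphi,\xi,\eta,g)$ satisfies $\varphi^2=-I+\eta\otimes\xi$, $\eta(\xi)=1$, $\varphi\xi=0$, $\eta\circ\varphi=0$, $g(\varphi X,\varphi Y)=g(X,Y)-\eta(X)\eta(Y)$, $d\eta(X,Y)=g(X,\varphi Y)$; put $h=\tfrac12\mathcal{L}_\xi\varphi$. It is an $N(\kappa)$-contact metric manifold ($\kappa$ a real constant) if $R(X,Y)\xi=\kappa[\eta(Y)X-\eta(X)Y]$ for all $X,Y$, where $R(X,Y)Z=\nabla_X\nabla_YZ-\nabla_Y\nabla_XZ-\nabla_{[X,Y]}Z$. $S$, $Q$, $r$ denote the Ricci tensor, the Ricci operator ($S(X,Y)=g(QX,Y)$) and the scalar curvature. Standing formulas the paper uses for every $N(\kappa)$-contact metric manifold considered: $S(X,Y)=2(n-1)g(X,Y)+2(n-1)g(hX,Y)+[2n\kappa-2(n-1)]\eta(X)\eta(Y)$, $S(X,\xi)=2n\kappa\,\eta(X)$, $r=2n(2n-2+\kappa)$. The $\mathcal{T}$-curvature tensor with coefficients $a_0,\dots,a_7$ (smooth functions on $M$) is $$\mathcal{T}(X_1,X_2)X_3=a_0R(X_1,X_2)X_3+a_1S(X_2,X_3)X_1+a_2S(X_1,X_3)X_2+a_3S(X_1,X_2)X_3+a_4g(X_2,X_3)QX_1+a_5g(X_1,X_3)QX_2+a_6g(X_1,X_2)QX_3+a_7r\bigl(g(X_2,X_3)X_1-g(X_1,X_3)X_2\bigr).$$ Special cases (coefficients not listed are $0$;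 $a_0=1$ except for $\mathcal{C}_\star,\mathcal{P}_\star$, where $a_0,a_1$ are free): $\mathcal{C}_\star$ (quasi-conformal): $a_1=-a_2=a_4=-a_5$, $a_7=-\frac1{2n+1}(\frac{a_0}{2n}+2a_1)$; $\mathcal{C}$ (conformal): $a_1=-a_2=a_4=-a_5=-\frac1{2n-1}$, $a_7=\frac1{2n(2n-1)}$; $\mathcal{L}$ (conharmonic): $a_1=-a_2=a_4=-a_5=-\frac1{2n-1}$; $\mathcal{V}$ (concircular): $a_7=-\frac1{2n(2n+1)}$; $\mathcal{P}_\star$ (pseudo-projective): $a_1=-a_2$, $a_7=-\frac1{2n+1}(\frac{a_0}{2n}+a_1)$; $\mathcal{P}$ (projective): $a_1=-a_2=-\frac1{2n}$; $\mathcal{M}$ ($M$-projective): $a_1=-a_2=a_4=-a_5=-\frac1{4n}$; $\mathcal{W}_0$: $a_1=-a_5=-\frac1{2n}$; $\mathcal{W}_0^\star$: $a_1=-a_5=\frac1{2n}$; $\mathcal{W}_1$: $a_1=-a_2=\frac1{2n}$; $\mathcal{W}_1^\star$: $a_1=-a_2=-\frac1{2n}$; $\mathcal{W}_2$: $a_4=-a_5=-\frac1{2n}$; $\mathcal{W}_3$: $a_2=-a_4=-\frac1{2n}$; $\mathcal{W}_4$: $a_5=-a_6=\frac1{2n}$; $\mathcal{W}_5$: $a_2=-a_5=-\frac1{2n}$; $\mathcal{W}_6$: $a_1=-a_6=-\frac1{2n}$; $\mathcal{W}_7$: $a_1=-a_4=-\frac1{2n}$; $\mathcal{W}_8$: $a_1=-a_3=-\frac1{2n}$;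 $\mathcal{W}_9$: $a_3=-a_4=\frac1{2n}$.
   Formalization: The free coefficients are restricted: for the quasi-conformal tensor a_0+(2n-1)a_1 must be nonzero at some point of M, and for the pseudo-projective tensor a_0 or a_1 must be nonzero at some point; otherwise the tensor is zero or a multiple of the conformal one and the claim fails. *)

(* Defs.v *)
From HB Require Import structures.
From mathcomp Require Import all_boot all_order all_algebra.
From mathcomp Require Import all_classical all_reals all_analysis.

Set Implicit Arguments.
Unset Strict Implicit.
Unset Printing Implicit Defensive.

Import Order.TTheory GRing.Theory Num.Theory.
Import numFieldNormedType.Exports.

Local Open Scope classical_set_scope.
Local Open Scope ring_scope.

(* C^k on an open set U; f is total, its values outside U are irrelevant
   because U is open. *)
Fixpoint Ck_on {R : realType} {V W : normedModType R} (k : nat)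
    (U : set V) (f : V -> W) : Prop :=
  match k with
  | 0 => forall x, U x -> {for x, continuous f}
  | k'.+1 => (forall x, U x -> differentiable f x) /\
             (forall v, Ck_on k' U (fun x => 'D_v f x))
  end.

Definition smooth_on {R : realType} {V W : normedModType R}
    (U : set V) (f : V -> W) : Prop := forall k, Ck_on k U f.

Record chart (R : realType) (m : nat) (M : topologicalType) := Chart {
  cdom : set M;
  cmap : M -> 'rV[R]_m;
  cinv : 'rV[R]_m -> M;
  cdom_open : open cdom;
  cimg_open : open (cmap @` cdom);
  cmapK : forall p, cdom p -> cinv (cmap p) = p;
  cmap_continuous : forall p, cdom p -> {for p, continuous cmap};
  cinv_continuous : forall x, (cmap @` cdom) x -> {for x, continuous cinv}
}.

(* The atlas is the family (chart_at p)_p, one chart around each point. *)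
Record manifold (R : realType) (m : nat) := Manifold {
  carrier :> topologicalType;
  manifold_hausdorff : hausdorff_space carrier;
  manifold_second_countable : @second_countable carrier;
  manifold_nonempty : [set: carrier] !=set0;
  chart_at : carrier -> chart R m carrier;
  chart_at_mem : forall p, cdom (chart_at p) p;
  transition_smooth : forall p q,
    smooth_on (cmap (chart_at p) @` (cdom (chart_at p) `&` cdom (chart_at q)))
              (cmap (chart_at q) \o cinv (chart_at p))
}.

Section Fields.
Context {R : realType} {m : nat} {M : manifold R m}.

Definition cimg (p : M) : set 'rV[R]_m :=
  cmap (chart_at p) @` cdom (chart_at p).

Definition smooth_fun (f : M -> R) : Prop :=
  forall p : M, smooth_on (cimg p) (f \o cinv (chart_at p)).

(* T_p M is 'rV[R]_m: a tangent vector at p is given by its components in the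
   coordinates of chart_at p.  A (not necessarily smooth) vector field is thus
   a function M -> 'rV[R]_m, tensors at p are matrices, and endomorphisms of
   T_p M act on row vectors from the right. *)
Definition vfield := M -> 'rV[R]_m.

(* Components of X in the coordinates of chart_at p, as a function of these
   coordinates: X q is pushed forward by the differential of the transition
   map from chart_at q to chart_at p. *)
Definition local_rep (p : M) (X : vfield) : 'rV[R]_m -> 'rV[R]_m := fun x =>
  let q := cinv (chart_at p) x in
  'D_(X q) (cmap (chart_at p) \o cinv (chart_at q)) (cmap (chart_at q) q).

Definition smooth_vfield (X : vfield) : Prop :=
  forall p : M, smooth_on (cimg p) (local_rep p X).

Definition vscale (f : M -> R) (X : vfield) : vfield := fun p => f p *: X p.

Definition act (X : vfield) (f : M -> R) : M -> R := fun p =>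
  'D_(X p) (f \o cinv (chart_at p)) (cmap (chart_at p) p).

Definition lie (X Y : vfield) : vfield := fun p =>
  'D_(X p) (local_rep p Y) (cmap (chart_at p) p)
  - 'D_(Y p) (local_rep p X) (cmap (chart_at p) p).

(* B(X, Y), eta(X) and A X for a field B of bilinear forms, a 1-form eta and a
   field A of endomorphisms. *)
Definition bil (B : M -> 'M[R]_m) (X Y : vfield) : M -> R := fun p =>
  (X p *m B p *m (Y p)^T) 0 0.
Definition form (eta : M -> 'cV[R]_m) (X : vfield) : M -> R := fun p =>
  (X p *m eta p) 0 0.
Definition app (A : M -> 'M[R]_m) (X : vfield) : vfield := fun p => X p *m A p.

(* Convention d eta(X,Y) = 1/2 (X eta(Y) - Y eta(X) - eta([X,Y])), the usual
   one in contact metric geometry. *)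
Definition dform (eta : M -> 'cV[R]_m) (X Y : vfield) : M -> R := fun p =>
  2^-1 * (act X (form eta Y) p - act Y (form eta X) p - form eta (lie X Y) p).

Record is_riemannian (g : M -> 'M[R]_m) : Prop := IsRiemannian {
  metric_sym : forall p, (g p)^T = g p;
  metric_pos : forall p (v : 'rV[R]_m), v != 0 -> 0 < (v *m g p *m v^T) 0 0;
  metric_smooth : forall X Y, smooth_vfield X -> smooth_vfield Y ->
    smooth_fun (bil g X Y)
}.

Record is_levi_civita (g : M -> 'M[R]_m) (nabla : vfield -> vfield -> vfield)
  : Prop := IsLeviCivita {
  nabla_smooth : forall X Y, smooth_vfield X -> smooth_vfield Y ->
    smooth_vfield (nabla X Y);
  nablaDl : forall X Y Z,
    smooth_vfield X -> smooth_vfield Y -> smooth_vfield Z ->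
    nabla (X \+ Y) Z = nabla X Z \+ nabla Y Z;
  nablaZl : forall f X Z,
    smooth_fun f -> smooth_vfield X -> smooth_vfield Z ->
    nabla (vscale f X) Z = vscale f (nabla X Z);
  nablaDr : forall X Y Z,
    smooth_vfield X -> smooth_vfield Y -> smooth_vfield Z ->
    nabla X (Y \+ Z) = nabla X Y \+ nabla X Z;
  nablaZr : forall f X Z,
    smooth_fun f -> smooth_vfield X -> smooth_vfield Z ->
    nabla X (vscale f Z) = vscale (act X f) Z \+ vscale f (nabla X Z);
  nabla_torsion_free : forall X Y, smooth_vfield X -> smooth_vfield Y ->
    nabla X Y \- nabla Y X = lie X Y;
  nabla_metric : forall X Y Z,
    smooth_vfield X -> smooth_vfield Y -> smooth_vfield Z ->
    act X (bil g Y Z) = bil g (nabla X Y) Z \+ bil g Y (nabla X Z)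
}.

Definition Riem (nabla : vfield -> vfield -> vfield) (X Y Z : vfield) : vfield :=
  nabla X (nabla Y Z) \- nabla Y (nabla X Z) \- nabla (lie X Y) Z.

(* Some smooth vector field with value v at p; one exists since M is Hausdorff.
   As Riem is tensorial, the choice does not affect [ricci] below. *)
Definition extend (p : M) (v : 'rV[R]_m) : vfield :=
  get [set X : vfield | smooth_vfield X /\ X p = v].

Definition coord_field (p : M) (i : 'I_m) : vfield := extend p (delta_mx 0 i).

(* S(Y, Z) = tr (X |-> R(X, Y) Z) *)
Definition ricci (nabla : vfield -> vfield -> vfield) : M -> 'M[R]_m := fun p =>
  \matrix_(i, j) \tr (\matrix_(k < m)
    Riem nabla (coord_field p k) (coord_field p i) (coord_field p j) p).

(* Q is determined by S(X, Y) = g(QX, Y), i.e. S p = Q p *m g p. *)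
Definition ricci_op (g : M -> 'M[R]_m) (nabla : vfield -> vfield -> vfield) :
    M -> 'M[R]_m := fun p => ricci nabla p *m invmx (g p).

Definition scalar_curv (g : M -> 'M[R]_m) (nabla : vfield -> vfield -> vfield) :
    M -> R := fun p => \tr (ricci_op g nabla p).

Record tcoefs := TCoefs {
  t0 : M -> R; t1 : M -> R; t2 : M -> R; t3 : M -> R;
  t4 : M -> R; t5 : M -> R; t6 : M -> R; t7 : M -> R
}.

Definition Tcurv (a : tcoefs) (g : M -> 'M[R]_m)
    (nabla : vfield -> vfield -> vfield) (X1 X2 X3 : vfield) : vfield := fun p =>
  let S := bil (ricci nabla) in
  let Q := app (ricci_op g nabla) in
  t0 a p *: Riem nabla X1 X2 X3 p
  + (t1 a p * S X2 X3 p) *: X1 p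
  + (t2 a p * S X1 X3 p) *: X2 p
  + (t3 a p * S X1 X2 p) *: X3 p
  + (t4 a p * bil g X2 X3 p) *: Q X1 p
  + (t5 a p * bil g X1 X3 p) *: Q X2 p
  + (t6 a p * bil g X1 X2 p) *: Q X3 p
  + (t7 a p * scalar_curv g nabla p) *:
      (bil g X2 X3 p *: X1 p - bil g X1 X3 p *: X2 p).

Definition Tflat (g : M -> 'M[R]_m) (nabla : vfield -> vfield -> vfield)
    (a : tcoefs) : Prop :=
  forall X1 X2 X3 X4, smooth_vfield X1 -> smooth_vfield X2 ->
    smooth_vfield X3 -> smooth_vfield X4 ->
    forall p, bil g (Tcurv a g nabla X1 X2 X3) X4 p = 0.

Definition ctcoefs (b0 b1 b2 b3 b4 b5 b6 b7 : R) : tcoefs :=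
  TCoefs (cst b0) (cst b1) (cst b2) (cst b3)
         (cst b4) (cst b5) (cst b6) (cst b7).

(* Here dim M = 2n+1.  When a0 + (2n-1) a1 = 0, [quasi_conformal n a0 a1] gives
   a0 times the conformal tensor. *)
Definition quasi_conformal (n : nat) (a0 a1 : M -> R) : tcoefs :=
  TCoefs a0 a1 (fun p => - a1 p) (cst 0) a1 (fun p => - a1 p) (cst 0)
    (fun p => - (2 * n%:R + 1)^-1 * (a0 p / (2 * n%:R) + 2 * a1 p)).
Definition pseudo_projective (n : nat) (a0 a1 : M -> R) : tcoefs :=
  TCoefs a0 a1 (fun p => - a1 p) (cst 0) (cst 0) (cst 0) (cst 0)
    (fun p => - (2 * n%:R + 1)^-1 * (a0 p / (2 * n%:R) + a1 p)).

Definition conformal (n : nat) : tcoefs :=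
  let c := (2 * n%:R - 1)^-1 in
  ctcoefs 1 (- c) c 0 (- c) c 0 (2 * n%:R * (2 * n%:R - 1))^-1.
Definition conharmonic (n : nat) : tcoefs :=
  let c := (2 * n%:R - 1)^-1 in ctcoefs 1 (- c) c 0 (- c) c 0 0.
Definition concircular (n : nat) : tcoefs :=
  ctcoefs 1 0 0 0 0 0 0 (- (2 * n%:R * (2 * n%:R + 1))^-1).
Definition projective (n : nat) : tcoefs :=
  let c := (2 * n%:R)^-1 in ctcoefs 1 (- c) c 0 0 0 0 0.
Definition M_projective (n : nat) : tcoefs :=
  let c := (4 * n%:R)^-1 in ctcoefs 1 (- c) c 0 (- c) c 0 0.

Definition W0 (n : nat) : tcoefs :=
  let c := (2 * n%:R)^-1 in ctcoefs 1 (- c) 0 0 0 c 0 0.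
Definition W0star (n : nat) : tcoefs :=
  let c := (2 * n%:R)^-1 in ctcoefs 1 c 0 0 0 (- c) 0 0.
Definition W1 (n : nat) : tcoefs :=
  let c := (2 * n%:R)^-1 in ctcoefs 1 c (- c) 0 0 0 0 0.
Definition W1star (n : nat) : tcoefs :=
  let c := (2 * n%:R)^-1 in ctcoefs 1 (- c) c 0 0 0 0 0.
Definition W2 (n : nat) : tcoefs :=
  let c := (2 * n%:R)^-1 in ctcoefs 1 0 0 0 (- c) c 0 0.
Definition W3 (n : nat) : tcoefs :=
  let c := (2 * n%:R)^-1 in ctcoefs 1 0 (- c) 0 c 0 0 0.
Definition W4 (n : nat) : tcoefs :=
  let c := (2 * n%:R)^-1 in ctcoefs 1 0 0 0 0 c (- c) 0.
Definition W5 (n : nat) : tcoefs :=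
  let c := (2 * n%:R)^-1 in ctcoefs 1 0 (- c) 0 0 c 0 0.
Definition W6 (n : nat) : tcoefs :=
  let c := (2 * n%:R)^-1 in ctcoefs 1 (- c) 0 0 0 0 c 0.
Definition W7 (n : nat) : tcoefs :=
  let c := (2 * n%:R)^-1 in ctcoefs 1 (- c) 0 0 c 0 0 0.
Definition W8 (n : nat) : tcoefs :=
  let c := (2 * n%:R)^-1 in ctcoefs 1 (- c) 0 c 0 0 0 0.
Definition W9 (n : nat) : tcoefs :=
  let c := (2 * n%:R)^-1 in ctcoefs 1 0 0 c (- c) 0 0 0.

(* With row vectors, phi (phi X) is X *m (phi *m phi), eta (X) xi is
   X *m (eta *m xi), phi xi is xi *m phi and eta (phi X) is X *m phi *m eta. *)
Record is_contact_metric (phi : M -> 'M[R]_m) (xi : vfield)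
    (eta : M -> 'cV[R]_m) (g : M -> 'M[R]_m) : Prop := IsContactMetric {
  contact_phi_smooth : forall X, smooth_vfield X -> smooth_vfield (app phi X);
  contact_xi_smooth : smooth_vfield xi;
  contact_eta_smooth : forall X, smooth_vfield X -> smooth_fun (form eta X);
  contact_riemannian : is_riemannian g;
  contact_phi2 : forall p, phi p *m phi p = - 1%:M + eta p *m xi p;
  contact_eta_xi : forall p, form eta xi p = 1;
  contact_phi_xi : forall p, xi p *m phi p = 0;
  contact_eta_phi : forall p, phi p *m eta p = 0;
  contact_compat : forall (X Y : vfield) p,
    bil g (app phi X) (app phi Y) p = bil g X Y p - form eta X p * form eta Y p;
  contact_deta : forall X Y, smooth_vfield X -> smooth_vfield Y ->
    forall p, dform eta X Y p = bil g X (app phi Y) p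
}.

(* h = 1/2 L_xi phi, with (L_xi phi) X = [xi, phi X] - phi [xi, X] *)
Definition htensor (phi : M -> 'M[R]_m) (xi : vfield) (X : vfield) : vfield :=
  fun p => 2^-1 *: (lie xi (app phi X) p - app phi (lie xi X) p).

Definition N_kappa (nabla : vfield -> vfield -> vfield) (xi : vfield)
    (eta : M -> 'cV[R]_m) (kappa : R) : Prop :=
  forall X Y, smooth_vfield X -> smooth_vfield Y ->
  forall p, Riem nabla X Y xi p =
    kappa *: (form eta Y p *: X p - form eta X p *: Y p).

(* These hold on every N(kappa)-contact metric manifold with kappa < 1 but can
   fail for kappa = 1 (e.g. on the round sphere S^(2n+1)). *)
Record N_kappa_ricci (n : nat) (phi : M -> 'M[R]_m) (xi : vfield)
    (eta : M -> 'cV[R]_m) (g : M -> 'M[R]_m)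
    (nabla : vfield -> vfield -> vfield) (kappa : R) : Prop := NKappaRicci {
  N_kappa_S : forall X Y, smooth_vfield X -> smooth_vfield Y ->
    forall p, bil (ricci nabla) X Y p =
      2 * (n%:R - 1) * bil g X Y p
      + 2 * (n%:R - 1) * bil g (htensor phi xi X) Y p
      + (2 * n%:R * kappa - 2 * (n%:R - 1)) * form eta X p * form eta Y p;
  N_kappa_S_xi : forall X, smooth_vfield X ->
    forall p, bil (ricci nabla) X xi p = 2 * n%:R * kappa * form eta X p;
  N_kappa_r : forall p,
    scalar_curv g nabla p = 2 * n%:R * (2 * n%:R - 2 + kappa)
}.

End Fields.

Arguments vfield {R m} M.
Arguments tcoefs {R m} M.

(* Main.v *)
Require Import Defs.
From HB Require Import structures.
From mathcomp Require Import all_boot all_order all_algebra.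
From mathcomp Require Import all_classical all_reals all_analysis.
From mathcomp Require Import ring lra.
Import Order.TTheory GRing.Theory Num.Theory.
Import numFieldNormedType.Exports.
(* Imported last so that form and metric_sym keep their meaning from the
   statement. *)
Import Defs.
Local Open Scope classical_set_scope.
Local Open Scope ring_scope.
Set Implicit Arguments.
Unset Strict Implicit.
Unset Printing Implicit Defensive.

(** Write S for the Ricci tensor, D = 2(n-1) and r = 2n(2n-2+kappa) for the
    scalar curvature.  Evaluate the flatness equation g(T(X1,X2)X3,X4) = 0 on
    xi and a horizontal field X (one with eta(X) = 0), in the three orders
    (X,xi,xi,X), (xi,X,xi,X) and (xi,X,X,xi).  All terms are then known: the
    curvature terms come from R(X,Y)xi = kappa(eta(Y)X - eta(X)Y), the Ricci
    terms are S(xi,xi) = 2n kappa, S(X,xi) = 0 and S(X,X).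

    The value S(X,X) = D g(X,X) + D g(hX,X) still involves h.  As h
    anticommutes with phi, replacing X by phi X changes the sign of g(hX,X)
    and keeps g(X,X), so h disappears from the sum of the equations for X and
    for phi X ([htensor_average], [ricci_average]).  Dividing by 2 g(X,X) leaves
    three linear relations between the coefficients of T at each point
    ([Tflat_coefficients]):
      a0 kappa + 2n kappa a1 + D a4 + a7 r = 0,
      - a0 kappa + 2n kappa a2 + D a5 - a7 r = 0,
      a0 kappa + D a1 + 2n kappa a4 + a7 r = 0,
    and each special case with a prescribed value solves one of them for kappa
    (for W7 two are needed: they force kappa = 0 and n = 1).

    The third relation contains g(R(xi,X)X,xi), in which R is not applied to
    xi.  It equals - g(X,R(xi,X)xi); the skew-symmetry of R in its last pair
    of arguments usually rests on the symmetry of second derivatives, but for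
    arguments that are orthogonal everywhere it follows from the compatibility
    of nabla with g alone, because then only derivatives of the zero function
    occur ([Riem_skew_orthogonal]).

    All this presupposes a smooth horizontal field that does not vanish at a
    given point, and so enough smooth vector fields on M.  They are built by
    hand: a constant field in a chart is multiplied by a bump function
    supported in the chart and extended by 0 ([exists_smooth_vfield]).  The
    extension is smooth because the support is compact, hence closed, M being
    Hausdorff.  Its smoothness in an arbitrary chart needs the stability of
    [Ck_on] under sums, products and composition, and the smoothness of the
    function exp(-1/t). *)

(** * Calculus of C^k functions *)

(** The difference g - f vanishes near x, so the zero map is a differential
    of it. *)
Lemma near_eq_differentiable (R : numFieldType) (V W : normedModType R)
    (f g : V -> W) (x : V) :
  (\forall y \near x, f y = g y) -> differentiable f x -> differentiable g x.
Proof.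
move=> fg df.
have -> : g = f + (g - f) by rewrite addrC subrK.
apply: differentiableD => //.
have hE : (g - f) \o shift x = cst ((g - f) x) + (\0 : {linear V -> W}) +o_ 0 id.
  apply/eqaddoP => /= e e0.
  have := fg; rewrite (near_shift 0) /= subr0 => fg0.
  near=> h.
  have -> : ((g - f) \o shift x - (cst ((g - f) x) + \0)) h = 0.
    rewrite /= !fctE addr0 -(nbhs_singleton fg) subrr subr0 /=.
    have -> : f (h + x) = g (h + x) by near: h; exact: fg0.
    exact: subrr.
  by rewrite normr0 mulr_ge0 // ltW.
apply/diff_locallyP.
have c0 : continuous (\0 : {linear V -> W}) by move=> y; exact: cvg_cst.
have dE := diff_unique c0 hE.
by rewrite dE.
Unshelve. all: by end_near. Qed.

Section CkCalculus.
Context {R : realType}.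
Implicit Types (V W : normedModType R).

(** Openness of U is what lets the derivatives of f and g agree on U as
    well. *)
Lemma Ck_on_ext V W k (U : set V) (f g : V -> W) : open U ->
  (forall x, U x -> f x = g x) -> Ck_on k U f -> Ck_on k U g.
Proof.
move=> oU; have near_fg f' g' : (forall x, U x -> f' x = g' x :> W) ->
    forall x, U x -> \forall y \near x, f' y = g' y.
  move=> fg x Ux; apply: (@filterS _ _ _ U) => //.
  by apply: open_nbhs_nbhs; split.
elim: k f g => [|k IH] f g fg /=.
  move=> cf x Ux.
  have cfx : {for x, continuous f} := cf x Ux.
  rewrite /prop_for /continuous_at -fg //.
  apply: cvg_trans cfx; apply: near_eq_cvg.
  exact: near_fg.
move=> [df Df]; split=> [x Ux|v].
  exact: near_eq_differentiable (near_fg _ _ fg x Ux) (df x Ux).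
apply: IH (Df v) => x Ux; apply: near_eq_derive.
exact: near_fg.
Qed.

Lemma Ck_onS V W k (U : set V) (f : V -> W) : Ck_on k.+1 U f -> Ck_on k U f.
Proof.
elim: k f => [|k IH] f [df Df].
  by move=> x /df /differentiable_continuous.
by split=> // v; apply: IH.
Qed.

(** [Ck_on] is a conjunction of conditions at the points of U, so smoothness
    can be checked piece by piece. *)
Lemma Ck_onU V W k (U1 U2 : set V) (f : V -> W) :
  Ck_on k U1 f -> Ck_on k U2 f -> Ck_on k (U1 `|` U2) f.
Proof.
elim: k f => [|k IH] f /=; first by move=> c1 c2 x [/c1|/c2].
move=> [d1 D1] [d2 D2]; split; first by move=> x [/d1|/d2].
by move=> v; apply: IH.
Qed.

Lemma Ck_on_subset V W k (U1 U2 : set V) (f : V -> W) :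
  U1 `<=` U2 -> Ck_on k U2 f -> Ck_on k U1 f.
Proof.
move=> U12; elim: k f => [|k IH] f /=; first by move=> c x /U12 /c.
move=> [d D]; split; first by move=> x /U12 /d.
by move=> v; apply: IH.
Qed.

Lemma Ck_on_cst V W k (U : set V) (c : W) : Ck_on k U (cst c : V -> W).
Proof.
elim: k c => [|k IH] c /=; first by move=> x _; exact: cvg_cst.
split=> [x _|v]; first exact: differentiable_cst.
rewrite (_ : (fun x => 'D_v (cst c) x) = cst 0); first exact: IH.
by apply/funext => x; rewrite derive_cst.
Qed.

Lemma Ck_onD V W k (U : set V) (f g : V -> W) : open U ->
  Ck_on k U f -> Ck_on k U g -> Ck_on k U (fun x => f x + g x).
Proof.
move=> oU; elim: k f g => [|k IH] f g /=.
  by move=> cf cg x Ux; apply: cvgD; [exact: cf|exact: cg].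
move=> [df Df] [dg Dg]; split=> [x Ux|v].
  exact: differentiableD (df x Ux) (dg x Ux).
apply: (Ck_on_ext oU _ (IH _ _ (Df v) (Dg v))) => x Ux.
by rewrite -deriveD //; apply: diff_derivable; [exact: df|exact: dg].
Qed.

Lemma Ck_on_sum V W k (U : set V) n (f : 'I_n -> V -> W) : open U ->
  (forall i, Ck_on k U (f i)) -> Ck_on k U (fun x => \sum_(i < n) f i x).
Proof.
move=> oU; elim: n f => [|n IH] f cf.
  rewrite (_ : (fun x => _) = cst 0); first exact: Ck_on_cst.
  by apply/funext => x; rewrite big_ord0.
rewrite (_ : (fun x => _) =
    (fun x => (\sum_(i < n) f (widen_ord (leqnSn n) i) x) + f ord_max x)).
  by apply: Ck_onD => //; apply: IH => i; exact: cf.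
by apply/funext => x; rewrite big_ord_recr.
Qed.

Lemma Ck_on_id (V : normedModType R) k (U : set V) : Ck_on k U (@idfun V).
Proof.
case: k => [|k] /=; first by move=> x _; exact: cvg_id.
split=> [x _|v]; first exact: ex_diff.
rewrite (_ : (fun x => _) = cst v); first exact: Ck_on_cst.
by apply/funext => x; rewrite derive_id.
Qed.

End CkCalculus.

Section Products.
Context {R : realType} (V W : normedModType R).

Lemma scale_is_bilinear :
  bilinear_for
    (GRing.Scale.Law.clone _ _ *:%R _) (GRing.Scale.Law.clone _ _ *:%R _)
    (@GRing.scale R W).
Proof.
split=> [u'|u] a x y /=.
- by rewrite scalerDl scalerA.
- by rewrite scalerDr !scalerA mulrC.
Qed.

Lemma differentiable_scale (a : V -> R) (f : V -> W) x :
  differentiable a x -> differentiable f x ->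
  differentiable (fun y => a y *: f y) x /\
  forall v, 'D_v (fun y => a y *: f y) x = 'D_v a x *: f x + a x *: 'D_v f x.
Proof.
move=> da df.
pose sM := bilinear_isBilinear.Build R R W W _ _ (@GRing.scale R W)
  scale_is_bilinear.
pose s : {bilinear R -> W -> W} := HB.pack (@GRing.scale R W) sM.
have sc : continuous (fun p : R * W => s p.1 p.2).
  by move=> p; exact: scale_continuous.
have dp := differentiable_pair da df.
have ds := differentiable_bilin (a x, f x) sc.
have dc : differentiable ((fun p : R * W => s p.1 p.2) \o (fun y => (a y, f y))) x.
  exact: differentiable_comp.
split=> [//|v].
rewrite [LHS](deriveE v dc) diff_comp // [LHS]/= (diff_pair da df).
rewrite (diff_bilin (a x, f x) sc) /=.
by rewrite !deriveE // addrC.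
Qed.

(** Leibniz rule: the derivative of a *: f is a sum of two products whose
    factors are of class C^k, which the induction on k absorbs. *)
Lemma Ck_onZ k (U : set V) (a : V -> R) (f : V -> W) : open U ->
  Ck_on k U a -> Ck_on k U f -> Ck_on k U (fun x => a x *: f x).
Proof.
move=> oU; elim: k a f => [|k IH] a f /=.
  by move=> ca cf x Ux; apply: cvgZ; [exact: ca|exact: cf].
move=> [da Da] [df Df]; split=> [x Ux|v].
  by have [] := differentiable_scale (da x Ux) (df x Ux).
have ca : Ck_on k U a by apply: Ck_onS.
have cf : Ck_on k U f by apply: Ck_onS.
apply: (Ck_on_ext oU _ (Ck_onD oU (IH _ _ (Da v) cf) (IH _ _ ca (Df v)))).
by move=> x Ux; have [_ ->] := differentiable_scale (da x Ux) (df x Ux).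
Qed.

End Products.

Section Coordinates.
Context {R : realType} {V : normedModType R} {m : nat}.

Lemma Ck_on_coord k (U : set V) (f : V -> 'rV[R]_m) (i : 'I_m) : open U ->
  Ck_on k U f -> Ck_on k U (fun x => f x 0 i).
Proof.
move=> oU; elim: k f => [|k IH] f /=.
  move=> cf x Ux.
  have cfx : {for x, continuous f} := cf x Ux.
  apply: (@continuous_comp _ _ _ f (fun M : 'rV[R]_m => M 0 i)) => //.
  exact: coord_continuous.
move=> [df Df]; split=> [x Ux|v].
  apply: (@differentiable_comp _ _ _ _ f (fun M : 'rV[R]_m => M 0 i : R)).
    exact: df.
  exact: differentiable_coord.
apply: (Ck_on_ext oU _ (IH _ (Df v))) => x Ux.
rewrite derive_mx ?mxE //; exact: diff_derivable (df x Ux).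
Qed.

(** The chain rule in coordinates.  Expanding the direction of derivation
    along the standard basis replaces derivatives of g in a varying direction,
    which [Ck_on] does not control, by partial derivatives of g. *)
Lemma derive_comp_coord (W : normedModType R) (f : V -> 'rV[R]_m)
    (g : 'rV[R]_m -> W) x v :
  differentiable f x -> differentiable g (f x) ->
  'D_v (g \o f) x = \sum_(i < m) ('D_v f x) 0 i *: 'D_(delta_mx 0 i) g (f x).
Proof.
move=> df dg; rewrite deriveE; last exact: differentiable_comp.
rewrite diff_comp //= -(deriveE v df) [in LHS](row_sum_delta ('D_v f x)).
rewrite linear_sum; apply: eq_bigr => i _.
by rewrite linearZ (deriveE _ dg).
Qed.

(** By [derive_comp_coord] a derivative of g \o f is a sum of products of
    coordinates of a derivative of f with partial derivatives of g composed
    with f; the induction on k runs over all g. *)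
Lemma Ck_on_comp (W : normedModType R) k (U : set V) (U' : set 'rV[R]_m)
    (f : V -> 'rV[R]_m) (g : 'rV[R]_m -> W) :
  open U -> (forall x, U x -> U' (f x)) ->
  Ck_on k U f -> Ck_on k U' g -> Ck_on k U (g \o f).
Proof.
move=> oU fU; elim: k g => [|k IH] g.
  move=> cf cg x Ux; apply: continuous_comp; first exact: cf.
  exact: cg (fU _ Ux).
move=> cf [dg Dg]; have [df Df] := cf.
split=> [x Ux|v].
  by apply: differentiable_comp; [exact: df|exact: dg (fU _ Ux)].
have cf' : Ck_on k U f by apply: Ck_onS.
apply: (@Ck_on_ext _ _ _ _ _
  (fun x => \sum_(i < m) ('D_v f x) 0 i *: 'D_(delta_mx 0 i) g (f x))) => //.
  move=> x Ux; rewrite derive_comp_coord //; first exact: df.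
  exact: dg (fU _ Ux).
apply: Ck_on_sum => // i; apply: Ck_onZ => //.
  by apply: Ck_on_coord => //; exact: Df.
by apply: (IH (fun y => 'D_(delta_mx 0 i) g y)) => //; exact: Dg.
Qed.

End Coordinates.

(** * The flat functions t^-k exp(-1/t) *)

Section FlatFunctions.
Context {R : realType}.

(** The family is indexed by k so as to be closed, up to linear combinations,
    under differentiation; k = 0 gives the function used for bumps. *)
Definition flat_fun (k : nat) (t : R) : R :=
  if 0 < t then t ^- k * expR (- t^-1) else 0.

Definition flat_fun_derivative (k : nat) (t : R) : R :=
  - k%:R * flat_fun k.+1 t + flat_fun k.+2 t.

Lemma flat_fun_le0 k (t : R) : t <= 0 -> flat_fun k t = 0.
Proof. by rewrite /flat_fun ltNge => ->. Qed.

Lemma flat_fun_gt0 k (t : R) : 0 < t -> 0 < flat_fun k t.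
Proof.
by move=> t0; rewrite /flat_fun t0 mulr_gt0 ?expR_gt0 // invr_gt0 exprn_gt0.
Qed.

(** Quadratic decay at 0, which is what differentiability there requires; it
    is the term of degree k+2 of the exponential series at 1/t. *)
Lemma flat_fun_le_sqr k (t : R) : 0 <= t -> flat_fun k t <= (k.+2)`!%:R * t ^+ 2.
Proof.
rewrite le_eqVlt => /predU1P[<-|t0].
  by rewrite flat_fun_le0 // expr2 mul0r mulr0.
have tV0 : 0 <= t^-1 by rewrite invr_ge0 ltW.
have fp : 0 < (k.+2)`!%:R :> R by rewrite ltr0n fact_gt0.
have := expR_ge1Dxn k.+1 tV0 => expr_ge.
have {}expr_ge : t ^- k.+2 / (k.+2)`!%:R <= expR t^-1.
  by rewrite -exprVn (le_trans _ expr_ge) // lerDr.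
have tk : 0 < t ^+ k.+2 by exact: exprn_gt0.
rewrite /flat_fun t0 expRN ler_pdivrMl ?exprn_gt0 // mulrCA -exprD addn2.
rewrite -[X in _ <= X]invrK lef_pV2 ?posrE ?expR_gt0 ?invr_gt0 //.
  by rewrite invfM mulrC.
by apply: mulr_gt0.
Qed.

Lemma is_derive_flat_fun k (t : R) :
  is_derive t 1 (flat_fun k) (flat_fun_derivative k t).
Proof.
have [t0|t0|->] := ltgtP t 0.
- apply: (@near_eq_is_derive _ _ _ (cst 0)).
    near=> s; rewrite /= flat_fun_le0 // ltW //; near: s.
    exact: lt_nbhsl.
  rewrite /flat_fun_derivative !flat_fun_le0 ?ltW // mulr0 addr0.
  exact: is_derive_cst.
- pose inv := fun s : R => s^-1.
  have tn0 : t != 0 by rewrite gt_eqF.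
  have dinv : is_derive t 1 inv (- t ^- 2).
    have := @is_deriveV _ id t 1 1 tn0 (is_derive_id _ _).
    by rewrite /GRing.scale /= mulr1.
  have dexp : is_derive t 1 (expR \o (- inv)) (expR (- t^-1) * (t ^- 2)).
    apply: is_derive1_comp; rewrite -[X in is_derive _ _ _ X]opprK.
    exact: is_deriveN.
  have h :
      is_derive t 1 (inv ^+ k * (expR \o (- inv))) (flat_fun_derivative k t).
    apply: is_derive_eq.
    rewrite /flat_fun_derivative /flat_fun t0 /GRing.scale /= exprfctE !fctE.
    rewrite /inv -!exprVn.
    set u := (X in X ^+ k.+1); set e := expR _.
    by case: k => [|k] /=; rewrite -/u !exprS ?expr0; ring.
  apply: near_eq_is_derive h.
  near=> s; rewrite /flat_fun ifT /=; first by rewrite fctE exprfctE /= exprVn.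
  by near: s; exact: lt_nbhsr.
(* At 0 the difference quotient is bounded by a multiple of the increment. *)
- have lim0 : h^-1 *: (flat_fun k (h *: 1 + 0) - flat_fun k 0) @[h --> (0 : R)^']
      --> (0 : R).
    apply/cvgr0Pnorm_le => e e0.
    pose C : R := (k.+2)`!%:R.
    have C0 : 0 < C by rewrite ltr0n fact_gt0.
    near=> h.
    rewrite (flat_fun_le0 k (lexx 0)) addr0 subr0 /GRing.scale /= mulr1.
    have [h0|h0] := leP h 0; first by rewrite flat_fun_le0 // mulr0 normr0 ltW.
    have he : `|h| <= e / C by near: h; apply: dnbhs0_le; exact: divr_gt0.
    rewrite gtr0_norm; last by rewrite mulr_gt0 ?invr_gt0 ?flat_fun_gt0.
    rewrite ler_pdivrMl //.
    apply: le_trans (flat_fun_le_sqr k (ltW h0)) _.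
    move: he; rewrite gtr0_norm // ler_pdivlMr // => he.
    by rewrite -/C expr2 mulrCA ler_pM2l // mulrC.
  have dE : 'D_1 (flat_fun k) (0 : R) = 0 by apply: cvg_lim.
  rewrite /flat_fun_derivative !flat_fun_le0 // mulr0 addr0.
  apply: DeriveDef => //; apply/cvg_ex; exists 0; exact: lim0.
Unshelve. all: by end_near.
Qed.

End FlatFunctions.

(** * Bump functions on row vectors *)

Section Bump.
Context {R : realType} {m : nat}.

(** A derivative of flat_fun j \o q is a combination of the next two flat
    functions composed with q, times a derivative of q; hence an induction
    on k for all j at once. *)
Lemma Ck_on_flat_comp (V : normedModType R) k j (U : set V) (q : V -> R) :
  open U -> Ck_on k U q -> Ck_on k U (flat_fun j \o q).
Proof.
move=> oU; have df i (t : R) : differentiable (flat_fun i) t.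
  by apply/derivable1_diffP; have [] := is_derive_flat_fun i t.
elim: k j q => [|k IH] j q.
  move=> cq x Ux; apply: continuous_comp; first exact: cq.
  exact: differentiable_continuous (df j (q x)).
move=> cq; have [dq Dq] := cq; split=> [x Ux|v].
  by apply: differentiable_comp; [exact: dq|exact: df].
have {}cq : Ck_on k U q by exact: Ck_onS.
apply: (@Ck_on_ext _ _ _ _ _ (fun x =>
    (- j%:R *: (flat_fun j.+1 \o q) x + (flat_fun j.+2 \o q) x) *: 'D_v q x)) => //.
  move=> x Ux; rewrite [RHS]deriveE; last exact: (differentiable_comp (dq x Ux)).
  rewrite (diff_comp (dq x Ux) (df _ _)) /= -(deriveE v (dq x Ux)).
  have [d1 d2] := is_derive_flat_fun j (q x).
  by rewrite (deriv1E d1) derive1E d2 /GRing.scale /= mulrC.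
apply: Ck_onZ => //; last exact: Dq.
apply: Ck_onD => //; last exact: IH.
by apply: Ck_onZ => //; [exact: Ck_on_cst|exact: IH].
Qed.

(** The Euclidean norm, rather than the sup norm of row vectors, makes the
    argument a polynomial in x. *)
Definition bump (c : 'rV[R]_m) (r : R) (x : 'rV[R]_m) : R :=
  flat_fun 0 (r ^+ 2 - \sum_(i < m) (x 0 i - c 0 i) ^+ 2).

Lemma smooth_bump c r : smooth_on setT (bump c r).
Proof.
have oT := @openT 'rV[R]_m.
move=> k; apply: Ck_on_flat_comp => //.
apply: Ck_onD => //; first exact: Ck_on_cst.
apply: (@Ck_on_ext _ _ _ _ _ (fun x : 'rV[R]_m => (-1 : R) *:
  (\sum_(i < m) ((x 0 i - c 0 i) *: (x 0 i - c 0 i) : R)))) => //.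
  by move=> x _; rewrite /GRing.scale /= mulN1r.
apply: Ck_onZ => //; first exact: Ck_on_cst.
have ci i : Ck_on k setT (fun x : 'rV[R]_m => x 0 i - c 0 i).
  apply: Ck_onD => //; last exact: Ck_on_cst.
  exact: (@Ck_on_coord _ _ _ _ _ idfun i oT (Ck_on_id _ _)).
by apply: Ck_on_sum => // i; apply: Ck_onZ.
Qed.

Lemma bump_center c (r : R) : 0 < r -> 0 < bump c r c.
Proof.
move=> r0; apply: flat_fun_gt0; rewrite big1 ?subr0 ?exprn_gt0 //.
by move=> i _; rewrite subrr expr0n.
Qed.

(** Closed sup-norm ball, described by coordinates. *)
Definition box (c : 'rV[R]_m) (r : R) : set 'rV[R]_m :=
  [set x | forall i, x ord0 i \in `[c 0 i - r, c 0 i + r]].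

Lemma box_compact c r : compact (box c r).
Proof.
apply: (@rV_compact R m (fun i => [set` `[c 0 i - r, c 0 i + r]])) => i.
exact: segment_compact.
Qed.

Lemma bump_support c (r : R) x : 0 < r -> ~ box c r x -> bump c r x = 0.
Proof.
move=> r0 nb; apply: flat_fun_le0; rewrite leNgt subr_gt0; apply/negP => lt_r.
apply: nb => i; rewrite in_itv /= -ler_distlC.
rewrite -(ler_pXn2r (n := 2)) ?nnegrE ?(ltW r0) // real_normK ?num_real //.
apply: le_trans (ltW lt_r); rewrite (bigD1 i) //= -sqrrN opprB lerDl.
by apply: sumr_ge0 => j _; exact: sqr_ge0.
Qed.

Lemma box_nbhs (c : 'rV[R]_m) (U : set 'rV[R]_m) : nbhs c U ->
  exists2 r : R, 0 < r & box c r `<=` U.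
Proof.
move=> /nbhs_ballP[e /= e0 eU]; exists (e / 2); first exact: divr_gt0.
move=> x bx; apply: eU; split=> // i j; rewrite (ord1 i) /ball /=.
have := bx j; rewrite in_itv /= -ler_distlC => /le_lt_trans.
apply.
by rewrite ltr_pdivrMr // ltr_pMr // ltr1n.
Qed.

End Bump.

(** * Smooth vector fields with a prescribed value *)

Section Extension.
Context {R : realType} {m : nat} {M : manifold R m}.
Implicit Types (a p q : M).

Definition overlap a p : set 'rV[R]_m :=
  cmap (chart_at a) @` (cdom (chart_at a) `&` cdom (chart_at p)).

Lemma cimg_cinv a x : cimg a x ->
  cdom (chart_at a) (cinv (chart_at a) x) /\
  cmap (chart_at a) (cinv (chart_at a) x) = x.
Proof. by move=> [q aq <-]; rewrite cmapK. Qed.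

Lemma cimg_nbhs_preimage a (A : set M) x : open A ->
  cimg a x -> A (cinv (chart_at a) x) ->
  \forall y \near x, cimg a y /\ A (cinv (chart_at a) y).
Proof.
move=> oA ax Ax; apply: filterI.
  by apply: open_nbhs_nbhs; split => //; exact: cimg_open.
have cx := @cinv_continuous _ _ _ (chart_at a) x ax.
by apply: cx; apply: open_nbhs_nbhs; split.
Qed.

Lemma open_cimg_preimage a (A : set M) : open A ->
  open [set x | cimg a x /\ A (cinv (chart_at a) x)].
Proof.
move=> oA; rewrite openE => x [ax Ax]; exact: cimg_nbhs_preimage.
Qed.

Lemma overlapE a p :
  overlap a p = [set x | cimg a x /\ cdom (chart_at p) (cinv (chart_at a) x)].
Proof.
apply/seteqP; split=> x /=.
  by move=> [q [aq pq] <-]; rewrite cmapK //; split=> //; exists q.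
move=> [/cimg_cinv[da ax] dp]; exists (cinv (chart_at a) x) => //.
Qed.

Lemma open_overlap a p : open (overlap a p).
Proof. by rewrite overlapE; apply: open_cimg_preimage; exact: cdom_open. Qed.

Lemma cmap_overlap a p q : cdom (chart_at a) q -> cdom (chart_at p) q ->
  overlap a p (cmap (chart_at a) q).
Proof. by move=> aq pq; exists q. Qed.

Lemma transition_differentiable a p x : overlap a p x ->
  differentiable (cmap (chart_at p) \o cinv (chart_at a)) x.
Proof. by move=> ax; have [d _] := transition_smooth a p 1%N; exact: d. Qed.

(** Components of tangent vectors transform functorially: passing from the
    chart at p to the one at q and then to the one at a is the same as passing
    from p to a directly, by the chain rule for the transition maps. *)
Lemma derive_transition_comp a p q x v : overlap p a x -> overlap p q x ->
  let y := cmap (chart_at q) (cinv (chart_at p) x) in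
  'D_('D_v (cmap (chart_at q) \o cinv (chart_at p)) x)
     (cmap (chart_at a) \o cinv (chart_at q)) y =
  'D_v (cmap (chart_at a) \o cinv (chart_at p)) x.
Proof.
move=> xa xq y.
have [dq yE] : cdom (chart_at q) (cinv (chart_at p) x) /\
    cinv (chart_at q) y = cinv (chart_at p) x.
  by move: xq; rewrite overlapE => -[_ dq]; rewrite /y cmapK.
have da : cdom (chart_at a) (cinv (chart_at p) x).
  by move: xa; rewrite overlapE => -[].
have d1 := transition_differentiable xq.
have d2 : differentiable (cmap (chart_at a) \o cinv (chart_at q)) y.
  by apply: transition_differentiable; exact: cmap_overlap.
rewrite [LHS]deriveE // [X in 'd _ _ X]deriveE //.
have := diff_comp d1 d2 => /(congr1 (fun F => F v)) /= <-.
rewrite -deriveE; last exact: differentiable_comp.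
apply: near_eq_derive.
have : \forall z \near x, overlap p q z.
  by apply: open_nbhs_nbhs; split=> //; exact: open_overlap.
apply: filterS => z; rewrite overlapE => -[_ dz].
by rewrite /= cmapK.
Qed.

(** The coordinate field with constant components v in the chart at p, cut off
    by a bump function and written, at each q, in the chart at q. *)
Definition bump_field p v r : vfield M := fun q =>
  if `[< cdom (chart_at p) q >] then
    bump (cmap (chart_at p) p) r (cmap (chart_at p) q) *:
      'D_v (cmap (chart_at q) \o cinv (chart_at p)) (cmap (chart_at p) q)
  else 0.

(** On the overlap with the chart at p the components in the chart at a are
    explicit smooth functions composed with a transition map. *)
Lemma local_rep_bump_field a p v r x : overlap a p x ->
  local_rep a (bump_field p v r) x =
  ((fun y => bump (cmap (chart_at p) p) r y *:
      'D_v (cmap (chart_at a) \o cinv (chart_at p)) y)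
    \o (cmap (chart_at p) \o cinv (chart_at a))) x.
Proof.
move=> xap; have := xap; rewrite overlapE => -[/cimg_cinv[da xE] dp].
rewrite /local_rep /bump_field; move: da xE dp.
set q := cinv (chart_at a) x => da xE dp; rewrite asboolT //=.
set y := cmap (chart_at p) q.
have dq := chart_at_mem q.
have yq : overlap p q y by exact: cmap_overlap.
have ya : overlap p a y by exact: cmap_overlap.
have := derive_transition_comp v ya yq.
rewrite /= {2}/y cmapK // => <-.
rewrite !(@deriveE _ _ _ (cmap (chart_at a) \o cinv (chart_at q))) ?linearZ //.
all: by apply: transition_differentiable; exact: cmap_overlap.
Qed.

Lemma local_rep_bump_field0 a p v (r : R) x : 0 < r -> cimg a x ->
  ~ (cinv (chart_at p) @` box (cmap (chart_at p) p) r) (cinv (chart_at a) x) ->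
  local_rep a (bump_field p v r) x = 0.
Proof.
move=> r0 ax nK; rewrite /local_rep /bump_field.
case: asboolP => [dp|_]; last by rewrite derive0.
rewrite bump_support ?scale0r ?derive0 // => bq; apply: nK.
exists (cmap (chart_at p) (cinv (chart_at a) x)) => //.
by rewrite cmapK.
Qed.

(** The image of the chart at a is covered by two open sets: the overlap
    with the chart at p, and the complement of the image K of the support.
    The second one is open because K is compact in a Hausdorff space. *)
Lemma smooth_bump_field p v (r : R) : 0 < r ->
  box (cmap (chart_at p) p) r `<=` cimg p -> smooth_vfield (bump_field p v r).
Proof.
move=> r0 br a k.
pose K := cinv (chart_at p) @` box (cmap (chart_at p) p) r.
have cK : closed K.
  apply: compact_closed; first exact: manifold_hausdorff.
  apply: continuous_compact; last exact: box_compact.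
  apply: continuous_in_subspaceT => x /set_mem /br px.
  exact: cinv_continuous.
pose U2 := [set x | cimg a x /\ (~` K) (cinv (chart_at a) x)].
have oU2 : open U2 by apply: open_cimg_preimage; exact: closed_openC.
apply: (@Ck_on_subset _ _ _ _ _ (overlap a p `|` U2)).
  move=> x ax; have [da xE] := cimg_cinv ax.
  have [dp|ndp] := pselect (cdom (chart_at p) (cinv (chart_at a) x)).
    by left; rewrite overlapE.
  right; split=> // -[y /br /cimg_cinv[dy _] yE].
  by apply: ndp; rewrite -yE.
apply: Ck_onU.
  apply: (@Ck_on_ext _ _ _ _ _ ((fun y => bump (cmap (chart_at p) p) r y *:
      'D_v (cmap (chart_at a) \o cinv (chart_at p)) y)
    \o (cmap (chart_at p) \o cinv (chart_at a)))).
  - exact: open_overlap.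
  - by move=> x xap; rewrite local_rep_bump_field.
  apply: (Ck_on_comp (U' := overlap p a)).
  - exact: open_overlap.
  - by move=> x; rewrite {1}overlapE => -[/cimg_cinv[da _] dp]; exact: cmap_overlap.
  - exact: transition_smooth.
  - apply: Ck_onZ; first exact: open_overlap.
      by apply: (@Ck_on_subset _ _ _ _ _ setT) => //; exact: smooth_bump.
    by have [_ D] := transition_smooth p a k.+1; exact: D.
apply: (@Ck_on_ext _ _ _ _ _ (cst 0)) => //; last exact: Ck_on_cst.
by move=> x [ax nK]; rewrite local_rep_bump_field0.
Qed.

(** The bump takes the value bump c r c at its center, not 1; the vector v is
    divided by it beforehand. *)
Lemma exists_smooth_vfield p (v : 'rV[R]_m) :
  exists X : vfield M, smooth_vfield X /\ X p = v.
Proof.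
pose c := cmap (chart_at p) p.
have dp := chart_at_mem p.
have cp : cimg p c by exists p.
have oc : \forall x \near c, cimg p x.
  by apply: open_nbhs_nbhs; split=> //; exact: cimg_open.
have [r r0 br] := box_nbhs oc.
exists (bump_field p ((bump c r c)^-1 *: v) r); split.
  exact: smooth_bump_field.
rewrite /bump_field asboolT // -/c.
have -> : 'D_((bump c r c)^-1 *: v)
    (cmap (chart_at p) \o cinv (chart_at p)) c = (bump c r c)^-1 *: v.
  rewrite -[RHS](derive_id c); apply: near_eq_derive.
  by apply: filterS oc => x /cimg_cinv[].
by rewrite scalerA divff ?scale1r // gt_eqF // bump_center.
Qed.

End Extension.

(** * Vector fields, metric and connection *)

Section FieldsAlgebra.
Context {R : realType} {m : nat} {M : manifold R m}.
Implicit Types (p : M) (X Y U V : vfield M).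

Lemma smooth_fun_cst (c : R) : smooth_fun (cst c : M -> R).
Proof. by move=> p k; exact: Ck_on_cst. Qed.

Lemma smooth_fun_differentiable (f : M -> R) p : smooth_fun f ->
  differentiable (f \o cinv (chart_at p)) (cmap (chart_at p) p).
Proof.
move=> sf; have [d _] := sf p 1%N; apply: d.
by exists p => //; exact: chart_at_mem.
Qed.

Lemma act_cst X (c : R) : act X (cst c) = cst 0.
Proof. by apply/funext => p; rewrite /act (_ : _ \o _ = cst c) ?derive_cst. Qed.

Lemma actD X (f1 f2 : M -> R) : smooth_fun f1 -> smooth_fun f2 ->
  act X (f1 \+ f2) = act X f1 \+ act X f2.
Proof.
move=> s1 s2; apply/funext => p; rewrite /act /=.
by rewrite -deriveD //; apply: diff_derivable; exact: smooth_fun_differentiable.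
Qed.

Lemma local_repB p X Y x : cimg p x ->
  local_rep p (X \- Y) x = local_rep p X x - local_rep p Y x.
Proof.
move=> px; have [dp _] := cimg_cinv px; rewrite /local_rep.
have dt : differentiable
    (cmap (chart_at p) \o cinv (chart_at (cinv (chart_at p) x)))
    (cmap (chart_at (cinv (chart_at p) x)) (cinv (chart_at p) x)).
  apply: transition_differentiable; apply: cmap_overlap => //.
  exact: chart_at_mem.
by rewrite !(deriveE _ dt) linearB.
Qed.

Lemma smooth_vfieldB X Y : smooth_vfield X -> smooth_vfield Y ->
  smooth_vfield (X \- Y).
Proof.
move=> sX sY p k.
have op : open (cimg p) by exact: cimg_open.
apply: (@Ck_on_ext _ _ _ _ _
  (fun x => local_rep p X x + (-1 : R) *: local_rep p Y x)) => //.
  by move=> x px; rewrite local_repB // scaleN1r.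
apply: Ck_onD => //; first exact: sX.
by apply: Ck_onZ => //; [exact: Ck_on_cst|exact: sY].
Qed.

Lemma bilBl (B : M -> 'M[R]_m) X Y V p :
  bil B (X \- Y) V p = bil B X V p - bil B Y V p.
Proof. by rewrite /bil /= !mulmxBl mxE [in X in _ + X]mxE. Qed.

Lemma bilBr (B : M -> 'M[R]_m) X Y V p :
  bil B V (X \- Y) p = bil B V X p - bil B V Y p.
Proof. by rewrite /bil /= linearB mulmxBr mxE [in X in _ + X]mxE. Qed.

Lemma bilC (g : M -> 'M[R]_m) X Y p : is_riemannian g ->
  bil g X Y p = bil g Y X p.
Proof.
move=> hg; rewrite /bil -[in RHS](metric_sym hg p)
  -[in LHS](trmxK (X p *m _ *m _)).
by rewrite mxE !trmx_mul trmxK mulmxA.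
Qed.

Lemma metric_unit (g : M -> 'M[R]_m) p : is_riemannian g -> g p \in unitmx.
Proof.
move=> hg; rewrite unitmxE unitfE; apply/negP => /det0P[v v0 vg].
by have := metric_pos hg p v0; rewrite vg mul0mx mxE ltxx.
Qed.

(** Torsion-freeness turns this into the linearity of nabla. *)
Lemma lie_opp (g : M -> 'M[R]_m)
    (nabla : vfield M -> vfield M -> vfield M) U X :
  is_levi_civita g nabla -> smooth_vfield U -> smooth_vfield X ->
  lie U (fun p => - X p) = (fun p => - lie U X p).
Proof.
move=> hn sU sX.
have oppE : (fun p => - X p) = vscale (cst (-1)) X.
  by apply/funext => p; rewrite /vscale /= scaleN1r.
have sc := smooth_fun_cst (-1).
have s0 : smooth_vfield (\0 : vfield M).
  rewrite (_ : \0 = U \- U); first exact: smooth_vfieldB.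
  by apply/funext => p /=; rewrite subrr.
have sN : smooth_vfield (vscale (cst (-1)) X).
  rewrite (_ : vscale _ _ = (\0 : vfield M) \- X); first exact: smooth_vfieldB.
  by apply/funext => p /=; rewrite /vscale /= scaleN1r sub0r.
rewrite oppE -(nabla_torsion_free hn sU sN) -(nabla_torsion_free hn sU sX).
rewrite (nablaZr hn) // (nablaZl hn) // act_cst.
apply/funext => p; rewrite /vscale /= scale0r add0r !scaleN1r.
by rewrite opprB addrC opprK.
Qed.

Lemma smooth_lie (g : M -> 'M[R]_m)
    (nabla : vfield M -> vfield M -> vfield M) U X :
  is_levi_civita g nabla -> smooth_vfield U -> smooth_vfield X ->
  smooth_vfield (lie U X).
Proof.
move=> hn sU sX; rewrite -(nabla_torsion_free hn sU sX).
by apply: smooth_vfieldB; exact: (nabla_smooth hn).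
Qed.

(** Differentiating g(X,Z) = 0 along A and then along B expresses
    g(nabla_B nabla_A X, Z) + g(X, nabla_B nabla_A Z) by terms that are
    symmetric in A and B, so they cancel in the commutator.  For general X and
    Z there would remain second derivatives of the function g(X,Z), whose
    commutator has to be compared with the derivative along the bracket. *)
Lemma Riem_skew_orthogonal (g : M -> 'M[R]_m)
    (nabla : vfield M -> vfield M -> vfield M) U V X Z :
  is_riemannian g -> is_levi_civita g nabla ->
  smooth_vfield U -> smooth_vfield V -> smooth_vfield X -> smooth_vfield Z ->
  bil g X Z = cst 0 ->
  forall p, bil g (Riem nabla U V X) Z p = - bil g X (Riem nabla U V Z) p.
Proof.
move=> hg hn sU sV sX sZ XZ p.
have sn A B : smooth_vfield A -> smooth_vfield B -> smooth_vfield (nabla A B).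
  exact: nabla_smooth hn A B.
have first A : smooth_vfield A ->
    bil g (nabla A X) Z \+ bil g X (nabla A Z) = cst 0.
  by move=> sA; rewrite -(nabla_metric hn) // XZ act_cst.
have second A B : smooth_vfield A -> smooth_vfield B ->
    bil g (nabla A (nabla B X)) Z p + bil g (nabla B X) (nabla A Z) p +
    (bil g (nabla A X) (nabla B Z) p + bil g X (nabla A (nabla B Z)) p) = 0.
  move=> sA sB; have sBX := sn _ _ sB sX; have sBZ := sn _ _ sB sZ.
  have := congr1 (fun f => act A f p) (first B sB).
  rewrite act_cst /= actD; [|exact: (metric_smooth hg)|exact: (metric_smooth hg)].
  by rewrite /= !(nabla_metric hn).
have sL : smooth_vfield (lie U V) by exact: smooth_lie hn sU sV.
have /(congr1 (fun f => f p)) /= L := first _ sL.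
have UV := second U V sU sV; have VU := second V U sV sU.
rewrite /Riem !bilBl !bilBr.
move: UV VU L.
move: (bil g (nabla U (nabla V X)) Z p) (bil g (nabla V (nabla U X)) Z p).
move: (bil g X (nabla U (nabla V Z)) p) (bil g X (nabla V (nabla U Z)) p).
move: (bil g (nabla V X) (nabla U Z) p) (bil g (nabla U X) (nabla V Z) p).
move: (bil g (nabla (lie U V) X) Z p) (bil g X (nabla (lie U V) Z) p).
by move=> *; lra.
Qed.

(** Only g(QX,Y) = S(X,Y) is not formal; it uses that g is invertible. *)
Lemma bil_Tcurv (a : tcoefs M) (g : M -> 'M[R]_m)
    (nabla : vfield M -> vfield M -> vfield M) X1 X2 X3 X4 p :
  is_riemannian g ->
  let S := bil (ricci nabla) in
  bil g (Tcurv a g nabla X1 X2 X3) X4 p =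
    t0 a p * bil g (Riem nabla X1 X2 X3) X4 p
    + t1 a p * S X2 X3 p * bil g X1 X4 p
    + t2 a p * S X1 X3 p * bil g X2 X4 p
    + t3 a p * S X1 X2 p * bil g X3 X4 p
    + t4 a p * bil g X2 X3 p * S X1 X4 p
    + t5 a p * bil g X1 X3 p * S X2 X4 p
    + t6 a p * bil g X1 X2 p * S X3 X4 p
    + t7 a p * scalar_curv g nabla p *
      (bil g X2 X3 p * bil g X1 X4 p - bil g X1 X3 p * bil g X2 X4 p).
Proof.
move=> hg S.
pose L (u : 'rV[R]_m) : R := (u *m g p *m (X4 p)^T) 0 0.
have LD u v : L (u + v) = L u + L v by rewrite /L !mulmxDl mxE.
have LZ c u : L (c *: u) = c * L u by rewrite /L -!scalemxAl mxE.
have LN u : L (- u) = - L u by rewrite /L !mulNmx mxE.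
have bE Y : bil g Y X4 p = L (Y p) by [].
have QE Y : S Y X4 p = L (app (ricci_op g nabla) Y p).
  by rewrite /L /app /ricci_op mulmxA mulmxKV // metric_unit.
by rewrite !bE !QE /Tcurv !(LD, LZ, LN) -/S.
Qed.

End FieldsAlgebra.

(** * Contact metric structures and flatness *)

Definition horizontal (R : realType) (m : nat) (M : manifold R m)
    (eta : M -> 'cV[R]_m) (X : vfield M) := form eta X = cst 0.

Section ContactMetric.
Context {R : realType} {m : nat} {M : manifold R m}.
Context {phi : M -> 'M[R]_m} {xi : vfield M} {eta : M -> 'cV[R]_m}
  {g : M -> 'M[R]_m} {nabla : vfield M -> vfield M -> vfield M}.
Context (hc : is_contact_metric phi xi eta g) (hn : is_levi_civita g nabla).
Implicit Types (p : M) (X Y : vfield M).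

Let hg := contact_riemannian hc.

Lemma horizontal_phi X : horizontal eta (app phi X).
Proof.
apply/funext => p; rewrite /form /app -mulmxA (contact_eta_phi hc) mulmx0.
by rewrite mxE.
Qed.

Lemma bil_xi X : bil g X xi = form eta X.
Proof.
apply/funext => p; have := contact_compat hc X xi p.
rewrite (contact_eta_xi hc) mulr1 => /esym/eqP; rewrite subr_eq => /eqP ->.
by rewrite {1}/bil {2}/app (contact_phi_xi hc) trmx0 mulmx0 mxE add0r.
Qed.

Lemma phi_phi_horizontal X : horizontal eta X ->
  app phi (app phi X) = (fun p => - X p).
Proof.
move=> hX; apply/funext => p; rewrite /app -mulmxA (contact_phi2 hc) mulmxDr.
have := congr1 (fun f => f p) hX; rewrite /form /= => X0.
rewrite mulmxN mulmx1 mulmxA (mx11_scalar (X p *m eta p)) X0.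
by rewrite mul_scalar_mx scale0r addr0.
Qed.

(** Compatibility of g with phi applied to X and phi Y, where
    phi (phi Y) = - Y + eta(Y) xi and g(phi X, xi) = eta(phi X) = 0. *)
Lemma bil_phi_skew X Y p :
  bil g (app phi X) Y p = - bil g X (app phi Y) p.
Proof.
have := contact_compat hc X (app phi Y) p.
have /(congr1 (fun f => f p)) /= -> := horizontal_phi Y.
rewrite mulr0 subr0 => <-.
have ppY : app phi (app phi Y) p = - Y p + form eta Y p *: xi p.
  rewrite /app -mulmxA (contact_phi2 hc) mulmxDr mulmxN mulmx1 mulmxA.
  by rewrite [X in X *m xi p]mx11_scalar mul_scalar_mx.
have /(congr1 (fun f => f p)) /= := bil_xi (app phi X).
have /(congr1 (fun f => f p)) /= -> := horizontal_phi X.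
rewrite /bil ppY linearD linearN linearZ /= mulmxDr mulmxN -scalemxAr.
move: (_ *m (Y p)^T) (_ *m (xi p)^T) => A B B0.
by rewrite !mxE B0 mulr0 addr0 opprK.
Qed.

(** By skew-symmetry of phi, 2 g(hY,Z) = g([xi,phi Y],Z) + g([xi,Y],phi Z).
    As phi (phi X) = - X for horizontal X, the two brackets that occur for
    phi X are, up to sign, those that occur for X. *)
Lemma htensor_average X p : smooth_vfield X -> horizontal eta X ->
  bil g (htensor phi xi X) X p +
  bil g (htensor phi xi (app phi X)) (app phi X) p = 0.
Proof.
move=> sX hX; have sxi := contact_xi_smooth hc.
have hE Y Z : bil g (htensor phi xi Y) Z p =
    2^-1 * (bil g (lie xi (app phi Y)) Z p + bil g (lie xi Y) (app phi Z) p).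
  rewrite -[X in _ + X]opprK -bil_phi_skew -bilBl.
  by rewrite /bil /htensor -!scalemxAl mxE.
have ppX := phi_phi_horizontal hX.
have lN : lie xi (app phi (app phi X)) = (fun q => - lie xi X q).
  by rewrite ppX; exact: lie_opp hn sxi sX.
apply: (etrans (congr2 +%R (hE X X) (hE (app phi X) (app phi X)))).
rewrite lN ppX.
move: (lie xi (app phi X)) => L2; move: (lie xi X) (app phi X) => L1 Y1.
have bN Y Z : bil g (fun q => - Y q) Z p = - bil g Y Z p.
  by rewrite /bil !mulNmx mxE.
have bNr Y Z : bil g Z (fun q => - Y q) p = - bil g Z Y p.
  by rewrite /bil linearN mulmxN mxE.
by rewrite (bN L1) (bNr X L2); ring.
Qed.

(** The values of phi are horizontal, and phi does not vanish at p: otherwise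
    the identity would be the matrix eta xi, of rank at most 1. *)
Lemma exists_horizontal p : (1 < m)%N ->
  exists X, [/\ smooth_vfield X, horizontal eta X & X p != 0].
Proof.
move=> m1.
have phi0 : phi p != 0.
  apply/eqP => phi0; have := contact_phi2 hc p.
  rewrite phi0 mul0mx => /esym/eqP; rewrite addrC subr_eq0 => /eqP e.
  have := mulmx_max_rank (eta p) (xi p).
  by rewrite e mxrank1 leqNgt m1.
have [i ri] : exists i, row i (phi p) != 0.
  apply/existsP; rewrite -[X in is_true X]negbK negb_exists.
  apply: contra phi0 => /forallP r0; apply/eqP/row_matrixP => i.
  by have := r0 i; rewrite negbK => /eqP ->; rewrite row0.
have [X0 [sX0 X0p]] := exists_smooth_vfield p (delta_mx 0 i).
exists (app phi X0); split.
- exact: (contact_phi_smooth hc).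
- exact: horizontal_phi.
- by rewrite /app X0p -rowE.
Qed.

End ContactMetric.

Section Flatness.
Context {R : realType} {n : nat} {M : manifold R (2 * n).+1}.
Context {phi : M -> 'M[R]_((2 * n).+1)} {xi : vfield M}
  {eta : M -> 'cV[R]_((2 * n).+1)} {g : M -> 'M[R]_((2 * n).+1)}
  {nabla : vfield M -> vfield M -> vfield M} {kappa : R}.
Context (hn0 : (0 < n)%N) (hc : is_contact_metric phi xi eta g)
  (hn : is_levi_civita g nabla) (hk : N_kappa nabla xi eta kappa)
  (hr : N_kappa_ricci n phi xi eta g nabla kappa).

Let hg := contact_riemannian hc.

(** Adding the values at X and phi X eliminates h. *)
Lemma ricci_average X p : smooth_vfield X -> horizontal eta X ->
  bil (ricci nabla) X X p + bil (ricci nabla) (app phi X) (app phi X) p =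
  2 * (2 * (n%:R - 1)) * bil g X X p.
Proof.
move=> sX hX.
have spX : smooth_vfield (app phi X) by exact: (contact_phi_smooth hc).
have hpX := horizontal_phi hc X.
have /(congr1 (fun f => f p)) /= X0 := hX.
have /(congr1 (fun f => f p)) /= pX0 := hpX.
rewrite !(N_kappa_S hr) // X0 pX0 (contact_compat hc) X0.
have sum0 (D s u w c : R) : u + w = 0 ->
    D * s + D * u + c * 0 * 0 + (D * (s - 0 * 0) + D * w + c * 0 * 0) = 2 * D * s.
  by move=> /eqP; rewrite addr_eq0 => /eqP ->; ring.
exact: sum0 (htensor_average hc hn p sX hX).
Qed.

(** Flatness evaluated on (X,xi,xi,X), (xi,X,xi,X) and (xi,X,X,xi). *)
Lemma Tflat_horizontal (a : tcoefs M) X p : Tflat g nabla a ->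
  smooth_vfield X -> horizontal eta X ->
  let s := bil g X X p in let S := bil (ricci nabla) X X p in
  let r := 2 * n%:R * (2 * n%:R - 2 + kappa) in
  [/\ t0 a p * kappa * s + t1 a p * (2 * n%:R * kappa) * s + t4 a p * S
        + t7 a p * r * s = 0,
      - t0 a p * kappa * s + t2 a p * (2 * n%:R * kappa) * s + t5 a p * S
        - t7 a p * r * s = 0 &
      t0 a p * kappa * s + t1 a p * S + t4 a p * (2 * n%:R * kappa) * s
        + t7 a p * r * s = 0].
Proof.
move=> fl sX hX s S r; have sxi := contact_xi_smooth hc.
have /(congr1 (fun f => f p)) /= X0 := hX.
have xx : bil g xi xi p = 1 by rewrite (bil_xi hc) (contact_eta_xi hc).
have Xx : bil g X xi p = 0 by rewrite (bil_xi hc) X0.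
have xX : bil g xi X p = 0 by rewrite bilC.
have Sxx : bil (ricci nabla) xi xi p = 2 * n%:R * kappa.
  by rewrite (N_kappa_S_xi hr) // (contact_eta_xi hc) mulr1.
have SXx : bil (ricci nabla) X xi p = 0 by rewrite (N_kappa_S_xi hr) // X0 mulr0.
have Rr c Y : Y p = c *: X p -> bil g X Y p = c * s.
  by move=> YE; rewrite /s /bil YE linearZ /= -scalemxAr mxE.
have R1 : bil g (Riem nabla X xi xi) X p = kappa * s.
  rewrite bilC // (Rr kappa) // hk // (contact_eta_xi hc) X0.
  by rewrite scale0r subr0 scale1r.
have RxiX : Riem nabla xi X xi p = - kappa *: X p.
  by rewrite hk // (contact_eta_xi hc) X0 scale0r sub0r scale1r scalerN scaleNr.
have R2 : bil g (Riem nabla xi X xi) X p = - kappa * s.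
  by rewrite bilC // (Rr (- kappa)).
have R3 : bil g (Riem nabla xi X X) xi p = kappa * s.
  rewrite (Riem_skew_orthogonal hg hn) //; last by rewrite (bil_xi hc).
  by rewrite (Rr (- kappa)) // mulNr opprK.
have F X1 X2 X3 X4 c : smooth_vfield X1 -> smooth_vfield X2 ->
    smooth_vfield X3 -> smooth_vfield X4 ->
    bil g (Riem nabla X1 X2 X3) X4 p = c -> 0 = _ :=
  fun s1 s2 s3 s4 Rc => etrans (esym (fl X1 X2 X3 X4 s1 s2 s3 s4 p))
    (etrans (bil_Tcurv a nabla X1 X2 X3 X4 p hg)
      (congr1 (fun z => t0 a p * z + _ + _ + _ + _ + _ + _ + _) Rc)).
have := F _ _ _ _ _ sX sxi sxi sX R1.
have := F _ _ _ _ _ sxi sX sxi sX R2.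
have := F _ _ _ _ _ sxi sX sX sxi R3.
rewrite (N_kappa_r hr) Sxx SXx Xx xX xx -/s -/S -/r => F3 F2 F1; split.
- by rewrite [RHS]F1; ring.
- by rewrite [RHS]F2; ring.
- by rewrite [RHS]F3; ring.
Qed.

(** Twice g(X,X) times each relation is the sum of the relations of
    [Tflat_horizontal] for X and for phi X. *)
Lemma Tflat_coefficients (a : tcoefs M) p : Tflat g nabla a ->
  let D := 2 * (n%:R - 1) in
  let r := 2 * n%:R * (2 * n%:R - 2 + kappa) in
  [/\ t0 a p * kappa + t1 a p * (2 * n%:R * kappa) + t4 a p * D + t7 a p * r = 0,
      - t0 a p * kappa + t2 a p * (2 * n%:R * kappa) + t5 a p * D
        - t7 a p * r = 0 &
      t0 a p * kappa + t1 a p * D + t4 a p * (2 * n%:R * kappa)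
        + t7 a p * r = 0].
Proof.
move=> fl D r.
have [X [sX hX Xp0]] :
    exists X, [/\ smooth_vfield X, horizontal eta X & X p != 0].
  by apply: (exists_horizontal hc); rewrite ltnS muln_gt0.
have spX : smooth_vfield (app phi X) by exact: (contact_phi_smooth hc).
have hpX := horizontal_phi hc X.
have s0 : 0 < bil g X X p by exact: (metric_pos hg).
have pX : bil g (app phi X) (app phi X) p = bil g X X p.
  rewrite (contact_compat hc); have /(congr1 (fun f => f p)) /= -> := hX.
  by rewrite mulr0 subr0.
have /= [F1 F2 F3] := Tflat_horizontal p fl sX hX.
have /= [G1 G2 G3] := Tflat_horizontal p fl spX hpX.
have /eqP := ricci_average p sX hX; rewrite eq_sym -subr_eq => /eqP SE.
rewrite pX in G1 G2 G3; rewrite -SE in F1 F2 F3.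
have cancel2 (x : R) : 2 * bil g X X p * x = 0 -> x = 0.
  by move=> /eqP; rewrite !mulf_eq0 (gt_eqF s0) pnatr_eq0 /= => /eqP.
split; apply: cancel2.
- by rewrite -[RHS](etrans (congr2 +%R F1 G1) (addr0 0)) /D /r; ring.
- by rewrite -[RHS](etrans (congr2 +%R F2 G2) (addr0 0)) /D /r; ring.
- by rewrite -[RHS](etrans (congr2 +%R F3 G3) (addr0 0)) /D /r; ring.
Qed.

End Flatness.

(** * The special curvature tensors *)

Unset Implicit Arguments.

Theorem theorem1 (R : realType) (n : nat) (hn : (0 < n)%N)
    (M : manifold R (2 * n).+1)
    (phi : M -> 'M[R]_((2 * n).+1)) (xi : vfield M)
    (eta : M -> 'cV[R]_((2 * n).+1)) (g : M -> 'M[R]_((2 * n).+1))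
    (nabla : vfield M -> vfield M -> vfield M) (kappa : R)
    (hcontact : is_contact_metric phi xi eta g)
    (hnabla : is_levi_civita g nabla)
    (hkappa : N_kappa nabla xi eta kappa)
    (hricci : N_kappa_ricci n phi xi eta g nabla kappa) :
  (* kappa = (n - 1) / n *)
  (forall a0 a1 : M -> R, smooth_fun a0 -> smooth_fun a1 ->
     (exists p : M, a0 p + (2 * n%:R - 1) * a1 p != 0) ->
     Tflat g nabla (quasi_conformal n a0 a1) -> kappa = (n%:R - 1) / n%:R) /\
  (Tflat g nabla (concircular n) -> kappa = (n%:R - 1) / n%:R) /\
  (forall a0 a1 : M -> R, smooth_fun a0 -> smooth_fun a1 ->
     (exists p : M, a0 p != 0 \/ a1 p != 0) ->
     Tflat g nabla (pseudo_projective n a0 a1) -> kappa = (n%:R - 1) / n%:R) /\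
  (Tflat g nabla (projective n) -> kappa = (n%:R - 1) / n%:R) /\
  (Tflat g nabla (M_projective n) -> kappa = (n%:R - 1) / n%:R) /\
  (Tflat g nabla (W0 n) -> kappa = (n%:R - 1) / n%:R) /\
  (Tflat g nabla (W1star n) -> kappa = (n%:R - 1) / n%:R) /\
  (Tflat g nabla (W6 n) -> kappa = (n%:R - 1) / n%:R) /\
  (Tflat g nabla (W8 n) -> kappa = (n%:R - 1) / n%:R) /\
  (* kappa = (1 - n) / n *)
  (Tflat g nabla (W0star n) -> kappa = (1 - n%:R) / n%:R) /\
  (Tflat g nabla (W1 n) -> kappa = (1 - n%:R) / n%:R) /\
  (* kappa = 2 - 2 n *)
  (Tflat g nabla (conharmonic n) -> kappa = 2 - 2 * n%:R) /\
  (* kappa = 0 *)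
  (Tflat g nabla (W3 n) -> kappa = 0) /\
  (Tflat g nabla (W4 n) -> kappa = 0) /\
  (Tflat g nabla (W5 n) -> kappa = 0) /\
  (* kappa = (n - 1) / (2 n) *)
  (Tflat g nabla (W7 n) -> kappa = (n%:R - 1) / (2 * n%:R)) /\
  (* kappa is a real number, with no specific value *)
  (Tflat g nabla (conformal n) -> kappa \is Num.real) /\
  (Tflat g nabla (W2 n) -> kappa \is Num.real) /\
  (Tflat g nabla (W9 n) -> kappa \is Num.real).
Proof.
have N0 : n%:R != 0 :> R by rewrite pnatr_eq0 -lt0n.
have N1 : 2 * n%:R + 1 != 0 :> R by rewrite -natrM natr1 pnatr_eq0.
have N2 : 2 * n%:R - 1 != 0 :> R.
  rewrite -natrM subr_eq0 -[1]/(1%:R) eqr_nat.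
  by case: (n) hn => // k _; rewrite mulnS.
have [p0 _] := manifold_nonempty M.
have coefs a p := @Tflat_coefficients _ _ _ _ _ _ _ _ _
  hn hcontact hnabla hkappa hricci a p.
(* Each case exhibits kappa - v as a multiple q of one of the relations. *)
have solve v q E : E = 0 -> kappa - v = q * E -> kappa = v.
  by move=> -> /eqP; rewrite mulr0 subr_eq0 => /eqP.
do !split.
- move=> a0 a1 _ _ [p ap] /(coefs _ p)[/= E1 _ _].
  apply: (solve _ ((2 * n%:R + 1) / (2 * n%:R * (a0 p + (2 * n%:R - 1) * a1 p))) _ E1).
  by field; rewrite N0 N1.
- move=> /(coefs _ p0)[/= E1 _ _].
  by apply: (solve _ ((2 * n%:R + 1) / (2 * n%:R)) _ E1); field; rewrite N0 N1.
- move=> a0 a1 _ _ [p ap] /(coefs _ p)[/= E1 _ E3].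
  have [a00|a0N] := eqVneq (a0 p + 2 * n%:R * a1 p) 0; last first.
    apply: (solve _ ((2 * n%:R + 1) / (2 * n%:R * (a0 p + 2 * n%:R * a1 p))) _ E1).
    by field; rewrite N0 N1.
  (* Here T is a multiple of the projective tensor and the first relation is
     trivial. *)
  have a0E : a0 p = - (2 * n%:R * a1 p) by apply/eqP; rewrite -addr_eq0 a00.
  have a1N : a1 p != 0.
    by case: ap => //; apply: contra => /eqP a10; rewrite a0E a10 mulr0 oppr0.
  apply: (solve _ (- (2 * n%:R * a1 p)^-1) _ E3); rewrite a0E.
  by field; rewrite N0 N1.
- move=> /(coefs _ p0)[/= _ _ E3]; apply: (solve _ 1 _ E3); by field.
- move=> /(coefs _ p0)[/= E1 _ _]; apply: (solve _ 2 _ E1); by field.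
- move=> /(coefs _ p0)[/= _ E2 _]; apply: (solve _ (-1) _ E2); by field.
- move=> /(coefs _ p0)[/= _ _ E3]; apply: (solve _ 1 _ E3); by field.
- move=> /(coefs _ p0)[/= _ _ E3]; apply: (solve _ 1 _ E3); by field.
- move=> /(coefs _ p0)[/= _ _ E3]; apply: (solve _ 1 _ E3); by field.
- move=> /(coefs _ p0)[/= _ _ E3]; apply: (solve _ 1 _ E3); by field.
- move=> /(coefs _ p0)[/= _ _ E3]; apply: (solve _ 1 _ E3); by field.
- move=> /(coefs _ p0)[/= E1 _ _].
  by apply: (solve _ (- (2 * n%:R - 1)) _ E1); field.
- move=> /(coefs _ p0)[/= _ E2 _]; apply: (solve _ (- 2^-1) _ E2); by field.
- move=> /(coefs _ p0)[/= E1 _ _]; apply: (solve _ 1 _ E1); by field.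
- move=> /(coefs _ p0)[/= E1 _ _]; apply: (solve _ 1 _ E1); by field.
- move=> /(coefs _ p0)[/= E1 E2 _].
  have k0 : kappa = 0 by apply: (solve _ (-1) _ E2); field.
  by apply: (solve _ (- 2^-1) _ E1); rewrite k0; field.
all: by move=> _; exact: num_real.
Qed.
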